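(* Let $\mathbb{F}$ be a field and let $(V_\bullet,f_\bullet)$ be a persistence module $V_0\xrightarrow{f_1}V_1\xrightarrow{f_2}\cdots\xrightarrow{f_\ell}V_\ell$ of finite-dimensional $\mathbb{F}$-vector spaces, with $n_i=\dim V_i$. Let $A_\bullet=(A_1,\dots,A_\ell)$ be the sequence of matrices representing $f_1,\dots,f_\ell$ with respect to an arbitrary choice of ordered bases of $V_0,\dots,V_\ell$, and let $$\mathrm{Stab}(A_\bullet)=\Big\{g=(g_0,\dots,g_\ell)\in\prod_{i=0}^{\ell}\mathrm{GL}(n_i;\mathbb{F}) \;\Big|\; g_iA_ig_{i-1}^{-1}=A_i\text{ for all }1\le i\le \ell\Big\}.$$ For $0\le i\le j\le\ell$ let $d_{ij}$ be the multiplicity of $[i,j]$ in the barcode of $(V_\bullet,f_\bullet)$ (with $d_{ij}=0$ if $[i,j]$ is not in the barcode). Then there is a bijection of sets $$\mathrm{Stab}(A_\bullet)\;\cong\;\prod_{0\le i\le j\le \ell}\mathrm{GL}(d_{ij};\mathbb{F})\;\times\prod_{\substack{[i_1,j_1]\preceq[i_2,j_2]\\ [i_1,j_1]\neq[i_2,j_2]}}\mathrm{Mat}(d_{i_1j_1}\times d_{i_2j_2};\mathbb{F}).$$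
   Context: For integers $0\le i\le j\le \ell$, the interval module $\mathbf{I}[i,j]_\bullet$ is the persistence module with $\mathbb{F}$ in positions $i,\dots,j$, $0$ elsewhere, and identity maps between consecutive copies of $\mathbb{F}$. Every persistence module is isomorphic to a direct sum $\bigoplus_{0\le i\le j\le \ell}\mathbf{I}[i,j]_\bullet^{d_{ij}}$ with uniquely determined multiplicities $d_{ij}\ge 0$; the barcode is the set of $[i,j]$ with $d_{ij}>0$. The binary relation $\preceq$ on intervals $\{[i,j]: 0\le i\le j\le \ell\}$ is: $[a,b]\preceq[c,d]$ iff $a\le c\le b\le d$. $\mathrm{Mat}(m\times n;\mathbb{F})$ is the set of $m\times n$ matrices over $\mathbb{F}$; $\mathrm{GL}(0;\mathbb{F})$ is the trivial group and $\mathrm{Mat}(m\times n;\mathbb{F})$ is a singleton if $m=0$ or $n=0$. *)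

(* Defs.v *)
From HB Require Import structures.
From mathcomp Require Import all_boot all_order all_algebra.

Set Implicit Arguments.
Unset Strict Implicit.
Unset Printing Implicit Defensive.

Import GRing.Theory.
Local Open Scope ring_scope.

(* The library puts a vector space structure on {ffun I -> V} only; this is   *)
(* the same pointwise structure for a family W of vector spaces.              *)
Definition dsumv (F : fieldType) (I : finType) (W : I -> vectType F) : Type :=
  {dffun forall x : I, W x}.

Import VectorInternalTheory.

Section DirectSumSpace.
Variables (F : fieldType) (I : finType) (W : I -> vectType F).
Local Notation D := (dsumv W).
Implicit Types f g h : D.

Definition dproj (x : I) (f : D) : W x := (f : {dffun forall y : I, W y}) x.

Definition dsumv_mk (s : forall x, W x) : D := [ffun x : I => s x].

Lemma dsumv_mkE s x : dproj x (dsumv_mk s) = s x.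
Proof. by rewrite /dproj ffunE. Qed.

Lemma dsumvP f g : (forall x, dproj x f = dproj x g) <-> f = g.
Proof. exact: (@ffunP _ (fun x => W x : Type) f g). Qed.

HB.instance Definition _ := Choice.on D.

Definition dsumv_zero : D := dsumv_mk (fun x => 0).
Definition dsumv_add f g : D := dsumv_mk (fun x => dproj x f + dproj x g).
Definition dsumv_opp f : D := dsumv_mk (fun x => - dproj x f).
Definition dsumv_scale (a : F) f : D := dsumv_mk (fun x => a *: dproj x f).

Fact dsumv_addA : associative dsumv_add.
Proof. by move=> f g h; apply/dsumvP => x; rewrite !dsumv_mkE addrA. Qed.
Fact dsumv_addC : commutative dsumv_add.
Proof. by move=> f g; apply/dsumvP => x; rewrite !dsumv_mkE addrC. Qed.
Fact dsumv_add0 : left_id dsumv_zero dsumv_add.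
Proof. by move=> f; apply/dsumvP => x; rewrite !dsumv_mkE add0r. Qed.
Fact dsumv_addN : left_inverse dsumv_zero dsumv_opp dsumv_add.
Proof. by move=> f; apply/dsumvP => x; rewrite !dsumv_mkE addNr. Qed.

HB.instance Definition _ :=
  GRing.isZmodule.Build D dsumv_addA dsumv_addC dsumv_add0 dsumv_addN.

Fact dsumv_scaleA a b f :
  dsumv_scale a (dsumv_scale b f) = dsumv_scale (a * b) f.
Proof. by apply/dsumvP => x; rewrite !dsumv_mkE scalerA. Qed.
Fact dsumv_scale1 : left_id 1 dsumv_scale.
Proof. by move=> f; apply/dsumvP => x; rewrite !dsumv_mkE scale1r. Qed.
Fact dsumv_scaleDr : right_distributive dsumv_scale +%R.
Proof. by move=> a f g; apply/dsumvP => x; rewrite !dsumv_mkE scalerDr. Qed.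
Fact dsumv_scaleDl f : {morph dsumv_scale^~ f : a b / a + b}.
Proof. by move=> a b; apply/dsumvP => x; rewrite !dsumv_mkE scalerDl. Qed.

HB.instance Definition _ := GRing.Zmodule_isLmodule.Build F D
  dsumv_scaleA dsumv_scale1 dsumv_scaleDr dsumv_scaleDl.

Lemma dsumv_addE f g x : dproj x (f + g) = dproj x f + dproj x g.
Proof. exact: dsumv_mkE. Qed.
Lemma dsumv_scaleE a f x : dproj x (a *: f) = a *: dproj x f.
Proof. exact: dsumv_mkE. Qed.

Fact dsumv_vect_iso :
  Vector.axiom #|{: {x : I & 'I_(dim (W x))}}| D.
Proof.
pose fr f : 'rV[F]_(#|{: {x : I & 'I_(dim (W x))}}|) :=
  \row_t v2r (dproj (tag (enum_val t)) f) 0 (tagged (enum_val t)).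
exists fr.
  move=> a f g; apply/rowP => t.
  by rewrite !mxE dsumv_addE dsumv_scaleE linearP !mxE.
pose T := {x : I & 'I_(dim (W x))}.
exists (fun r : 'rV[F]_#|{: T}| => dsumv_mk (fun x =>
  r2v (\row_j r 0 (enum_rank (Tagged (fun y => 'I_(dim (W y))) j))))).
  move=> f; apply/dsumvP => x; rewrite dsumv_mkE -[RHS]v2rK; congr r2v.
  by apply/rowP => j; rewrite !mxE enum_rankK.
move=> r; apply/rowP => t; rewrite mxE dsumv_mkE r2vK mxE.
by congr (r 0 _); rewrite -[RHS]enum_valK; case: (enum_val t).
Qed.

HB.instance Definition _ := Lmodule_hasFinDim.Build F D dsumv_vect_iso.

End DirectSumSpace.

Section PersistenceModules.
Variables (F : fieldType) (l : nat).

(* The l arrows are indexed by i : 'I_l; the arrow i goes from position i to  *)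
(* position i + 1, so it is f_(i+1) in the numbering f_1, ..., f_l.           *)
Definition src (i : 'I_l) : 'I_l.+1 := widen_ord (leqnSn l) i.
Definition tgt (i : 'I_l) : 'I_l.+1 := lift ord0 i.

Record persmod := PersMod {
  pspace :> 'I_l.+1 -> vectType F;
  parrow : forall i : 'I_l, 'Hom(pspace (src i), pspace (tgt i)) }.

Definition persmod_iso (V W : persmod) : Prop :=
  exists phi : forall k : 'I_l.+1, 'Hom(V k, W k),
    (forall i : 'I_l,
       (phi (tgt i) \o parrow V i = parrow W i \o phi (src i))%VF)
    /\ (forall k, bijective (phi k)).

Definition dsum_map (I : finType) (W : I -> persmod) (i : 'I_l)
    (f : dsumv (fun x => W x (src i))) : dsumv (fun x => W x (tgt i)) :=
  dsumv_mk (fun x => parrow (W x) i (dproj x f)).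

Fact dsum_map_linear I W i : linear (@dsum_map I W i).
Proof.
move=> a f g; apply/dsumvP => x.
by rewrite !(dsumv_mkE, dsumv_addE, dsumv_scaleE) linearP.
Qed.

HB.instance Definition _ I W i :=
  GRing.isLinear.Build F _ _ _ (@dsum_map I W i) (@dsum_map_linear I W i).

Definition dsum (I : finType) (W : I -> persmod) : persmod :=
  @PersMod (fun k => dsumv (fun x => W x k))
    (fun i => linfun (@dsum_map I W i)).

Definition pinterval : Type := {p : 'I_l.+1 * 'I_l.+1 | (p.1 <= p.2)%N}.
HB.instance Definition _ := Finite.on pinterval.

Definition ilo (x : pinterval) : 'I_l.+1 := (val x).1.
Definition ihi (x : pinterval) : 'I_l.+1 := (val x).2.

Definition prec (x y : pinterval) : bool :=
  [&& ilo x <= ilo y, ilo y <= ihi x & ihi x <= ihi y]%N.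

(* The space at k is F^1 if k lies in x and F^0 otherwise (the boolean is     *)
(* coerced to the dimension). pid_mx 1 is the identity matrix between two     *)
(* copies of F^1, and the unique (zero) map as soon as one side is F^0.       *)
Definition interval_mod (x : pinterval) : persmod :=
  @PersMod (fun k => 'cV[F]_((ilo x <= k <= ihi x)%N : bool))
    (fun i => linfun (mulmx (pid_mx 1))).

(* V is isomorphic to the direct sum of d x copies of each interval module x; *)
(* x is in the barcode of V iff d x > 0.                                      *)
Definition has_multiplicities (V : persmod) (d : pinterval -> nat) : Prop :=
  persmod_iso V (dsum (fun t : {x : pinterval & 'I_(d x)} =>
                         interval_mod (tag t))).

(* mxof acts on row vectors; the transpose acts on columns of coordinates, so *)
(* that a change of bases g turns A_i into g_i A_i g_(i-1)^-1.                *)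
Definition repr_mx (V : persmod) (e : forall k, (\dim {:V k}).-tuple (V k))
    (i : 'I_l) : 'M[F]_(\dim {:V (tgt i)}, \dim {:V (src i)}) :=
  (passmx.mxof (e (src i)) (e (tgt i)) (parrow V i))^T.

(* {'GL_n[F]} requires F finite, and has size n.-1.+1, hence 1 for n = 0.    *)
Definition GL (n : nat) : Type := {M : 'M[F]_n | M \in unitmx}.

Definition Stab (n : 'I_l.+1 -> nat)
    (A : forall i : 'I_l, 'M[F]_(n (tgt i), n (src i))) : Type :=
  {g : {dffun forall k : 'I_l.+1, GL (n k)} |
    [forall i : 'I_l,
       val (g (tgt i)) *m A i *m invmx (val (g (src i))) == A i]}.

Definition GL_prod (d : pinterval -> nat) : Type :=
  {dffun forall x : pinterval, GL (d x)}.

Definition prec_pair : Type :=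
  {p : pinterval * pinterval | prec p.1 p.2 && (p.1 != p.2)}.
HB.instance Definition _ := Finite.on prec_pair.

Definition Mat_prod (d : pinterval -> nat) : Type :=
  {dffun forall p : prec_pair, 'M[F]_(d (val p).1, d (val p).2)}.

End PersistenceModules.

(* Main.v *)
Require Import Defs.
From mathcomp Require Import all_boot all_order all_algebra zify.

(** In bases adapted to the interval decomposition, an endomorphism of the module
    at position k is a matrix indexed by the bars alive at k. Commutation with
    the arrows makes the (s, t) entry independent of k and forces it to vanish
    unless the interval of s precedes that of t; so an endomorphism is one matrix
    M indexed by all bars, whose blocks M_xy with x preceding y are arbitrary and
    whose other blocks are 0. The diagonal blocks of an endomorphism and of its
    inverse are mutually inverse, because precedence is antisymmetric.
    Conversely, if all M_xx are invertible then M is invertible at every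
    position: a row vector in the kernel has zero component at every interval,
    by looking at an interval with minimal sum of endpoints among the others. *)

Set Implicit Arguments.
Unset Strict Implicit.
Unset Printing Implicit Defensive.

Import GRing.Theory.

Section IntervalMatrices.
Local Open Scope ring_scope.
Variables (F : fieldType) (l : nat).
Implicit Types (x y : pinterval l) (k : 'I_l.+1).

Definition covers x k : bool := (ilo x <= k <= ihi x)%N.

Lemma ilo_le_ihi x : (ilo x <= ihi x)%N.
Proof. exact: valP x. Qed.

Lemma prec_anti x y : prec x y -> prec y x -> x = y.
Proof.
move=> /and3P[a1 _ a2] /and3P[b1 _ b2]; apply: val_inj.
rewrite [LHS]surjective_pairing [RHS]surjective_pairing.
by congr pair; apply: val_inj; apply/eqP; rewrite eqn_leq ?a1 ?a2 ?b1 ?b2.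
Qed.

Lemma prec_refl x : prec x x.
Proof. by rewrite /prec !leqnn ilo_le_ihi. Qed.

(** * Morphisms between two interval modules *)

Section IntervalHom.
Variables (x y : pinterval l) (f : 'I_l.+1 -> F).
Hypothesis f_supp : forall k, ~~ (covers x k && covers y k) -> f k = 0.
Hypothesis f_arrow : forall i : 'I_l,
  (covers y (src i))%:R * f (tgt i) = (covers x (tgt i))%:R * f (src i).

(** Here [f] is a morphism from the interval module of [y] to that of [x], one scalar per position.
    The square of an arrow that stays inside [y] and ends inside [x] equates the values at its two
    ends; induction goes down from [k]. *)
Lemma interval_hom_const (j k : 'I_l.+1) :
  covers x k -> covers y k -> (ilo y <= j <= k)%N -> f k = f j.
Proof.
case: k => k kl; rewrite /covers /=.
elim: k kl => [|k IHk] kl xk yk /andP[jy jk].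
  by congr f; apply: val_inj => /=; lia.
have [jE|jn] := eqVneq (nat_of_ord j) k.+1; first by congr f; apply: val_inj.
have kl' : (k < l)%N by [].
pose i := Ordinal kl'; pose k' := Ordinal (ltnW kl).
have si : src i = k' by apply: val_inj.
have ti : tgt i = Ordinal kl by apply: val_inj.
have := f_arrow i; rewrite si ti /covers /= xk mul1r.
have -> : (ilo y <= k <= ihi y)%N by lia.
rewrite mul1r => ->.
have [xk'|xk'] := boolP (ilo x <= k <= ihi x)%N.
  by apply: IHk => //; rewrite /=; lia.
(* Now [k < ilo x], so [x] contains neither [k] nor [j], and both values are 0. *)
by rewrite !f_supp //= negb_and /covers /=; lia.
Qed.

(** If [prec x y] fails although [k] lies in both intervals, either [y] starts before [x] and [f] is
    0 at [ilo y] by support, or [y] ends before [x]. In the latter case the square leaving [ihi y]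
    makes [f] vanish at [ihi y], and constancy carries this back to [ilo y]. *)
Lemma interval_homE k : covers x k -> covers y k ->
  f k = if prec x y then f (ilo y) else 0.
Proof.
move=> xk yk; have xl := ilo_le_ihi x; have yl := ilo_le_ihi y.
rewrite (@interval_hom_const (ilo y) k) //; last by move: yk; rewrite /covers; lia.
case: ifP => // /negbT nxy.
have [xy|xy] := ltnP (ilo y) (ilo x).
  by apply: f_supp; rewrite negb_and /covers; lia.
have hyx : (ihi y < ihi x)%N.
  by move: nxy xk yk; rewrite /prec /covers; lia.
have hl : (ihi y < l)%N by have := ltn_ord (ihi x); lia.
pose i := Ordinal hl.
have si : src i = ihi y by apply: val_inj.
have := f_arrow i; rewrite si.
have -> : covers x (tgt i).
  by move: xk yk hyx; rewrite /covers /= /bump /=; lia.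
rewrite [f (tgt i)]f_supp; last first.
  by rewrite negb_and /covers /= /bump /=; lia.
rewrite mulr0 mul1r => /esym <-.
apply/esym/interval_hom_const; move: xk yk; rewrite /covers; lia.
Qed.

End IntervalHom.

(** * Matrices indexed by bars, and their blocks *)

Section Blocks.
Variable d : pinterval l -> nat.

Definition bar : finType := {x : pinterval l & 'I_(d x)}.
Definition nbars : nat := #|{: bar}|.

Definition btype (t : 'I_nbars) : pinterval l := tag (enum_val t).
Definition bidx x (a : 'I_(d x)) : 'I_nbars :=
  enum_rank (Tagged (fun y => 'I_(d y)) a : bar).

Lemma btype_bidx x (a : 'I_(d x)) : btype (bidx a) = x.
Proof. by rewrite /btype enum_rankK. Qed.

Lemma bidxP (t : 'I_nbars) : exists a : 'I_(d (btype t)), t = bidx a.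
Proof.
exists (tagged (enum_val t)); rewrite -[LHS]enum_valK; congr enum_rank.
by rewrite /btype; case: (enum_val t).
Qed.

Definition block (M : 'M[F]_nbars) x y : 'M[F]_(d x, d y) :=
  \matrix_(a, b) M (bidx a) (bidx b).

Definition of_blocks (B : forall x y, 'M[F]_(d x, d y)) : 'M[F]_nbars :=
  \matrix_(s, t) B _ _ (tagged (enum_val s)) (tagged (enum_val t)).

Lemma blockK M : of_blocks (block M) = M.
Proof.
apply/matrixP=> s t; rewrite !mxE.
have E u : bidx (tagged (enum_val u)) = u.
  rewrite -[RHS]enum_valK; congr enum_rank.
  by case: (enum_val u).
by rewrite !E.
Qed.

Lemma of_blocksK B x y : block (of_blocks B) x y = B x y.
Proof. by apply/matrixP=> a b; rewrite !mxE /bidx !enum_rankK. Qed.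

Lemma eq_of_blocks B B' : (forall x y, B x y = B' x y) ->
  of_blocks B = of_blocks B'.
Proof. by move=> E; apply/matrixP=> s t; rewrite !mxE E. Qed.

Definition supp_prec (M : 'M[F]_nbars) : Prop :=
  forall x y, ~~ prec x y -> block M x y = 0.

Lemma supp_precE M s t : supp_prec M -> ~~ prec (btype s) (btype t) ->
  M s t = 0.
Proof.
have [a sE] := bidxP s; have [b tE] := bidxP t.
by move=> sM /sM /matrixP /(_ a b); rewrite !mxE -sE -tE.
Qed.

Lemma supp_precP (M : 'M[F]_nbars) :
  (forall s t, ~~ prec (btype s) (btype t) -> M s t = 0) ->
  supp_prec M.
Proof.
by move=> sM x y nxy; apply/matrixP=> a b; rewrite !mxE sM // !btype_bidx.
Qed.

(** One index set serves all positions: this projector cuts off the bars dead at [k]. *)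
Definition alive k : 'M[F]_nbars :=
  diag_mx (\row_t (covers (btype t) k)%:R).

Definition col_block m (w : 'M[F]_(m, nbars)) x : 'M[F]_(m, d x) :=
  \matrix_(a, b) w a (bidx b).

Lemma col_block_mul m (w : 'M[F]_(m, nbars)) M x :
  col_block (w *m M) x = \sum_y col_block w y *m block M y x.
Proof.
apply/matrixP=> a b; rewrite summxE !mxE.
pose G y (c : 'I_(d y)) := w a (bidx c) * M (bidx c) (bidx b).
transitivity (\sum_(u : bar) G _ (tagged u)).
  rewrite (reindex (@enum_rank bar)) /=; last first.
    by exists enum_val => u _; [rewrite enum_rankK|rewrite enum_valK].
  by apply: eq_bigr => -[y c] _.
rewrite -(@sig_big_dep _ _ _ _ _ xpredT (fun=> xpredT) G) /=.
by apply: eq_bigr => y _; rewrite mxE; apply: eq_bigr => c _; rewrite !mxE.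
Qed.

Lemma block_mul M M' x y :
  block (M *m M') x y = \sum_z block M x z *m block M' z y.
Proof.
have blockE M0 z : block M0 x z = col_block (rowsub (@bidx x) M0) z.
  by apply/matrixP=> a b; rewrite !mxE.
rewrite blockE -mul_rowsub_mx col_block_mul.
by apply: eq_bigr => z _; rewrite blockE.
Qed.

Lemma col_block_eq0 m (w : 'M[F]_(m, nbars)) :
  (forall x, col_block w x = 0) -> w = 0.
Proof.
move=> w0; apply/matrixP=> a t; have [b tE] := bidxP t.
have /matrixP/(_ a b) := w0 (btype t).
by rewrite !mxE -tE.
Qed.

Lemma mul_alivel k (M : 'M[F]_nbars) s t :
  (alive k *m M) s t = (covers (btype s) k)%:R * M s t.
Proof. by rewrite mul_diag_mx !mxE. Qed.

Lemma mul_aliver k (M : 'M[F]_nbars) s t :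
  (M *m alive k) s t = (covers (btype t) k)%:R * M s t.
Proof. by rewrite mul_mx_diag !mxE mulrC. Qed.

Lemma block_alivel k M x y :
  block (alive k *m M) x y = (covers x k)%:R *: block M x y.
Proof. by apply/matrixP=> a b; rewrite [LHS]mxE mul_alivel btype_bidx !mxE. Qed.

Lemma block_aliver k M x y :
  block (M *m alive k) x y = (covers y k)%:R *: block M x y.
Proof. by apply/matrixP=> a b; rewrite [LHS]mxE mul_aliver btype_bidx !mxE. Qed.

Lemma block1 x : block 1%:M x x = 1%:M.
Proof.
apply/matrixP=> a b; rewrite !mxE; congr (_ %:R).
by rewrite (inj_eq enum_rank_inj) -tag_eqE /tag_eq /= eqxx tagged_asE.
Qed.

(** An intermediate interval [y] contributes only if [x] precedes [y] and [y] precedes [x], so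
    antisymmetry leaves [y = x] alone. *)
Lemma block_mul_diag k M M' x : supp_prec M -> supp_prec M' -> covers x k ->
  block (M *m alive k *m M') x x = block M x x *m block M' x x.
Proof.
move=> sM sM' xk; rewrite block_mul (bigD1 x) //= big1 ?addr0.
  by rewrite block_aliver xk scale1r.
move=> y yx; rewrite block_aliver.
have [xy|/sM ->] := boolP (prec x y); last by rewrite scaler0 mul0mx.
have [yx'|/sM' ->] := boolP (prec y x); last by rewrite mulmx0.
by rewrite (prec_anti xy yx') eqxx in yx.
Qed.

(** * Endomorphisms of the module as matrices on bars *)

Section Representation.
Variables (n : 'I_l.+1 -> nat).
Variable A : forall i : 'I_l, 'M[F]_(n (tgt i), n (src i)).
(* [U k] has the generators of the bars alive at [k] as columns (0 for the other
   bars), and [C k] computes the coordinates on these generators. *)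
Variables (U : forall k, 'M[F]_(n k, nbars)) (C : forall k, 'M[F]_(nbars, n k)).
Hypothesis UC : forall k, U k *m C k = 1%:M.
Hypothesis CU : forall k, C k *m U k = alive k.
Hypothesis AU : forall i, A i *m U (src i) = U (tgt i) *m alive (src i).

Lemma U_alive k : U k *m alive k = U k.
Proof. by rewrite -CU mulmxA UC mul1mx. Qed.

Lemma alive_C k : alive k *m C k = C k.
Proof. by rewrite -CU -mulmxA UC mulmx1. Qed.

(** The dual of [AU], for coordinates instead of generators: inserting [U *m C = 1] after [A i]
    makes [AU] applicable. *)
Lemma CA i : C (tgt i) *m A i = alive (tgt i) *m C (src i).
Proof.
rewrite -[A i]mulmx1 -(UC (src i)) 2!mulmxA -(mulmxA (C _)) AU mulmxA CU.
by rewrite -mulmxA alive_C.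
Qed.

Lemma alive_idem k : alive k *m alive k = alive k.
Proof. by rewrite -{2}CU mulmxA alive_C CU. Qed.

Definition commuting (h : forall k, 'M[F]_(n k)) : Prop :=
  forall i, h (tgt i) *m A i = A i *m h (src i).

Definition restrict (M : 'M[F]_nbars) k : 'M[F]_(n k) := U k *m M *m C k.

(* The entry (s, t) is read at the first position of t, which lies in both bars
   as soon as s precedes t. *)
Definition glue (h : forall k, 'M[F]_(n k)) : 'M[F]_nbars :=
  \matrix_(s, t) if prec (btype s) (btype t)
    then (C (ilo (btype t)) *m h _ *m U _) s t else 0.

Lemma glue_supp h : supp_prec (glue h).
Proof. by apply: supp_precP => s t /negbTE nst; rewrite mxE nst. Qed.

(** For fixed [s] and [t], the entries at varying positions form a morphism from the interval module
    of [t] to that of [s], so [interval_homE] applies. *)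
Lemma coord_glue h k : commuting h ->
  C k *m h k *m U k = alive k *m glue h *m alive k.
Proof.
move=> hA; apply/matrixP=> s t; rewrite mul_aliver mul_alivel [glue h s t]mxE.
pose f j := (C j *m h j *m U j) s t.
have fE j : f j = (covers (btype s) j)%:R * ((covers (btype t) j)%:R * f j).
  rewrite -mul_aliver -mul_alivel; congr (fun M : 'M_ _ => M s t).
  by rewrite !mulmxA alive_C -!mulmxA U_alive.
rewrite -/(f k) fE.
have [sk|_] := boolP (covers (btype s) k); last by rewrite !mul0r mulr0.
have [tk|_] := boolP (covers (btype t) k); last by rewrite !mul0r mulr0.
rewrite !mul1r; apply: (@interval_homE (btype s) (btype t) f) => // [j|i].
  by rewrite fE; do 2!case: covers => //=; rewrite ?mul0r ?mulr0.
(* The commutation square of [h] at the arrow [i], in bar coordinates. *)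
rewrite -mul_aliver -mul_alivel; congr (fun M : 'M_ _ => M s t).
by rewrite -mulmxA -AU 2!mulmxA -(mulmxA (C _)) hA !mulmxA CA.
Qed.

Lemma restrict_glue h k : commuting h -> restrict (glue h) k = h k.
Proof.
move=> hA; rewrite /restrict -U_alive -(mulmxA _ (alive k)) -alive_C.
rewrite mulmxA -(mulmxA (U k)) -coord_glue // !mulmxA UC mul1mx.
by rewrite -mulmxA UC mulmx1.
Qed.

(** The two sides could differ only where [t] is alive at the source and [s] at the target. If [s]
    precedes [t], then [s] starts no later and [t] ends no earlier, so both bars are alive at both
    ends. *)
Lemma restrict_commuting M : supp_prec M -> commuting (restrict M).
Proof.
move=> sM i; rewrite /restrict -mulmxA CA !mulmxA AU.
rewrite -[U (tgt i)]U_alive -[C (src i)]alive_C !mulmxA -!(mulmxA (U (tgt i))).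
congr (_ *m (_ *m _)); apply/matrixP=> s t.
rewrite !mul_aliver -!mulmxA !mul_alivel.
have [st|/(supp_precE sM) ->] := boolP (prec (btype s) (btype t)); last first.
  by rewrite ?mul_aliver !mulr0.
have [tk|_] := boolP (covers (btype t) (src i)); last by rewrite !mul0r.
have [sk|_] := boolP (covers (btype s) (tgt i)); last by rewrite !(mul0r, mulr0).
suff [-> ->] : covers (btype t) (tgt i) /\ covers (btype s) (src i) by [].
by move: st tk sk; rewrite /prec /covers /= /bump /=; lia.
Qed.

Lemma glue_restrict M : supp_prec M -> glue (restrict M) = M.
Proof.
move=> sM; apply/matrixP=> s t; rewrite mxE.
case: ifPn => [st|/(supp_precE sM) -> //].
rewrite /restrict !mulmxA CU -2!mulmxA CU mulmxA mul_aliver mul_alivel.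
have -> : covers (btype s) (ilo (btype t)) by move: st; rewrite /prec /covers; lia.
have -> : covers (btype t) (ilo (btype t)).
  by have := ilo_le_ihi (btype t); rewrite /covers; lia.
by rewrite !mul1r.
Qed.

Lemma block_glue_mul h h' x : commuting h -> commuting h' ->
  (forall k, h k *m h' k = 1%:M) ->
  block (glue h) x x *m block (glue h') x x = 1%:M.
Proof.
move=> hA h'A hh'; pose k := ilo x.
have xk : covers x k by rewrite /covers leqnn ilo_le_ihi.
rewrite -(@block_mul_diag k) //; try exact: glue_supp.
(* The product need only be compared with the identity between bars alive at [k], and those of type
   [x] are among them. *)
have : alive k *m (glue h *m alive k *m glue h') *m alive k
       = alive k *m 1%:M *m alive k.
  rewrite mulmx1 -{2}alive_idem !mulmxA -coord_glue // -!mulmxA.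
  rewrite (mulmxA (alive k)) -coord_glue // -!mulmxA.
  rewrite (mulmxA (U k)) UC mul1mx (mulmxA (h k)) hh' mul1mx CU.
  by rewrite alive_idem.
move/(congr1 (fun M => block M x x)).
by rewrite !block_aliver !block_alivel !xk !scale1r block1.
Qed.

Lemma restrict_unit M k : supp_prec M ->
  (forall x, block M x x \in unitmx) -> restrict M k \in unitmx.
Proof.
move=> sM uM; rewrite -row_free_unit; apply: inj_row_free => v v0.
suff w0 : v *m U k = 0 by rewrite -[v]mulmx1 -(UC k) mulmxA w0 mul0mx.
set w := v *m U k.
have wk : w *m alive k = w by rewrite /w -mulmxA U_alive.
have wM : w *m M *m alive k = 0.
  by rewrite -CU /w !mulmxA -2!(mulmxA v) v0 mul0mx.
have colk m (u : 'M_(m, _)) x :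
    col_block (u *m alive k) x = (covers x k)%:R *: col_block u x.
  by apply/matrixP=> a b; rewrite mul_mx_diag !mxE btype_bidx mulrC.
have [x0 nz0|w0] := pickP (fun x => col_block w x != 0); last first.
  by apply: col_block_eq0 => x; have /eqP := w0 x.
case: (@arg_minnP _ x0 (fun x => col_block w x != 0)
         (fun x => ilo x + ihi x)%N nz0) => x nzx minx.
have xk : covers x k.
  apply: contraNT nzx => /negbTE nxk.
  by rewrite -wk colk nxk scale0r.
have := congr1 (fun u => col_block u x) wM.
rewrite /= colk xk scale1r col_block_mul (bigD1 x) //= big1 => [|y yx].
  rewrite addr0 => wx0; case/negP: nzx; apply/eqP.
  rewrite -[col_block w x](mulmxK (uM x)) wx0.
  by apply/matrixP => a b; rewrite !mxE big1 // => c _; rewrite !mxE mul0r.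
have [px|/sM ->] := boolP (prec y x); last by rewrite mulmx0.
have [->|nzy] := eqVneq (col_block w y) 0; first by rewrite mul0mx.
(* Precedence orders both endpoints, so minimality of the sum at [x] turns these inequalities into
   equalities, and [x] precedes [y] as well. *)
case/negP: yx; apply/eqP; apply: (prec_anti px).
by move: px (minx y nzy) (ilo_le_ihi y) (ilo_le_ihi x); rewrite /prec; lia.
Qed.

(** * The bijection between the stabilizer and the block data *)

Definition glue_stab (g : Stab A) := glue (fun k => val (val g k)).

Lemma stab_commuting (g : Stab A) : commuting (fun k => val (val g k)).
Proof.
move=> i; have /forallP/(_ i)/eqP {2}<- := valP g.
by rewrite mulmxKV // (valP (val g (src i))).
Qed.

Lemma commuting_inv h : (forall k, h k \in unitmx) -> commuting h ->
  commuting (fun k => invmx (h k)).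
Proof.
move=> uh hA i; apply: (can_inj (mulKmx (uh (tgt i)))).
by rewrite mulKVmx // mulmxA hA mulmxK.
Qed.

Lemma glue_stab_unit (g : Stab A) x : block (glue_stab g) x x \in unitmx.
Proof.
have uh k : val (val g k) \in unitmx := valP (val g k).
have := block_glue_mul x (stab_commuting g)
          (commuting_inv uh (stab_commuting g)) (fun k => mulmxV (uh k)).
by case/mulmx1_unit.
Qed.

Definition to_blocks (g : Stab A) : GL_prod F d * Mat_prod F d :=
  ([ffun x => exist (fun M : 'M[F]_(d x) => M \in unitmx)
                    (block (glue_stab g) x x) (glue_stab_unit g x)],
   [ffun p : prec_pair l => block (glue_stab g) (val p).1 (val p).2]).

(* [decP] rather than [eqP] or [boolP]: a case analysis then leaves the
   boolean alone on which the type of [xy] depends. *)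
Definition pblocks (q : GL_prod F d * Mat_prod F d) x y : 'M[F]_(d x, d y) :=
  match decP (@eqP _ x y), decP (@idP (prec x y && (x != y))) with
  | left xy, _ => castmx (erefl, congr1 d xy) (val (q.1 x))
  | _, left xy => q.2 (exist _ (x, y) xy)
  | _, _ => 0
  end.

Lemma pblocks_diag q x : pblocks q x x = val (q.1 x).
Proof. by rewrite /pblocks; case: decP => // xx; rewrite castmx_id. Qed.

Lemma pblocks_pair q (p : prec_pair l) :
  pblocks q (val p).1 (val p).2 = q.2 p.
Proof.
case: p => -[x y] /= xy; rewrite /pblocks.
case: decP => [xy'|_]; first by case/andP: (xy) => _ /eqP.
case: decP => [xy'|//].
by rewrite (bool_irrelevance xy' xy).
Qed.

Lemma pblocks0 q x y : ~~ prec x y -> pblocks q x y = 0.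
Proof.
rewrite /pblocks; case: decP => [xy|_ nxy].
  by case: _ / xy; rewrite prec_refl.
by case: decP => // xy; case/andP: (xy) => /(negP nxy).
Qed.

Lemma pblocks_supp q : supp_prec (of_blocks (pblocks q)).
Proof. by move=> x y nxy; rewrite of_blocksK pblocks0. Qed.

Lemma pblocks_unit q k : restrict (of_blocks (pblocks q)) k \in unitmx.
Proof.
apply: restrict_unit; first exact: pblocks_supp.
by move=> x; rewrite of_blocksK pblocks_diag (valP (q.1 x)).
Qed.

Lemma stab_intro (h : {dffun forall k, GL F (n k)}) :
  commuting (fun k => val (h k)) ->
  [forall i, val (h (tgt i)) *m A i *m invmx (val (h (src i))) == A i].
Proof.
move=> hA; apply/forallP => i.
by rewrite hA mulmxK // (valP (h (src i))).
Qed.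

Definition pblocks_ffun q : {dffun forall k, GL F (n k)} :=
  [ffun k => exist (fun M : 'M[F]_(n k) => M \in unitmx) _ (pblocks_unit q k)].

Lemma pblocks_commuting q : commuting (fun k => val (pblocks_ffun q k)).
Proof.
by move=> i; rewrite !ffunE; apply: restrict_commuting; exact: pblocks_supp.
Qed.

Definition of_pblocks q : Stab A :=
  exist _ (pblocks_ffun q) (stab_intro (pblocks_commuting q)).

(** No information is lost: the blocks that [to_blocks] omits are 0 by [glue_supp]. *)
Lemma pblocks_to_blocks g x y :
  pblocks (to_blocks g) x y = block (glue_stab g) x y.
Proof.
have [<-|xy] := eqVneq x y; first by rewrite pblocks_diag ffunE.
have [pxy|npxy] := boolP (prec x y); last first.
  by rewrite pblocks0 // glue_supp.
have pP : prec (x, y).1 (x, y).2 && ((x, y).1 != (x, y).2) by rewrite pxy xy.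
by rewrite (pblocks_pair (to_blocks g) (exist _ (x, y) pP)) ffunE.
Qed.

Lemma eq_glue h h' : (forall k, h k = h' k) -> glue h = glue h'.
Proof. by move=> E; apply/matrixP=> s t; rewrite !mxE E. Qed.

Lemma to_blocksK : cancel to_blocks of_pblocks.
Proof.
move=> g; apply: val_inj; apply/ffunP => k; apply: val_inj.
rewrite ffunE /= (eq_of_blocks (pblocks_to_blocks g)) blockK.
exact: (restrict_glue k (stab_commuting g)).
Qed.

Lemma glue_of_pblocks q : glue_stab (of_pblocks q) = of_blocks (pblocks q).
Proof.
rewrite -[RHS]glue_restrict; last exact: pblocks_supp.
by apply: eq_glue => k; rewrite ffunE.
Qed.

Lemma of_pblocksK : cancel of_pblocks to_blocks.
Proof.
move=> q; rewrite [RHS]surjective_pairing; congr pair; apply/ffunP => x.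
  apply: val_inj; rewrite ffunE /=.
  by rewrite glue_of_pblocks of_blocksK pblocks_diag.
by rewrite ffunE glue_of_pblocks of_blocksK pblocks_pair.
Qed.

Lemma to_blocks_bij : bijective to_blocks.
Proof. by exists of_pblocks; [exact: to_blocksK|exact: of_pblocksK]. Qed.

End Representation.
End Blocks.
End IntervalMatrices.

(** * Generators and coordinates of a sum of interval modules *)

Section Coordinates.
Local Open Scope ring_scope.
Variables (F : fieldType) (l : nat) (d : pinterval l -> nat).

Definition bar_sum : persmod F l :=
  dsum (fun t : bar d => interval_mod F (tag t)).

(** If [t] is dead at [k], then [const_mx 1] is a column of height 0 and the generator is 0. *)
Definition gen k (t : bar d) : bar_sum k :=
  dsumv_mk (W := fun s : bar d => interval_mod F (tag s) k)
    (fun s => if s == t then const_mx 1 else 0).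

(* The component of [w] at [t] lives in F^1 or F^0, and the sum reads it off
   as a scalar, which is 0 in the second case. *)
Definition bar_coord k (t : bar d) (w : bar_sum k) : F :=
  \sum_j (dproj t w : 'cV[F]_(_ : bool)) j 0.

Lemma bar_coord_sum k t m (a : 'I_m -> F) (w : 'I_m -> bar_sum k) :
  bar_coord t (\sum_j a j *: w j) = \sum_j a j * bar_coord t (w j).
Proof.
have cD : {morph @bar_coord k t : u v / u + v}.
  move=> u v; rewrite /bar_coord -big_split; apply: eq_bigr => j _.
  by rewrite dsumv_addE mxE.
have c0 : bar_coord t (0 : bar_sum k) = 0.
  by apply: (addrI (bar_coord t (0 : bar_sum k))); rewrite -cD !addr0.
rewrite (big_morph _ cD c0); apply: eq_bigr => i _.
rewrite /bar_coord big_distrr; apply: eq_bigr => j _.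
by rewrite dsumv_scaleE mxE.
Qed.

Lemma bar_coord_gen k s t :
  bar_coord s (gen k t) = ((s == t) && covers (tag t) k)%:R.
Proof.
rewrite /bar_coord dsumv_mkE; case: eqP => [->|_] /=; last first.
  by rewrite big1 // => j _; rewrite mxE.
rewrite -/(covers (tag t) k); case: covers.
  by rewrite big_ord1 mxE.
by rewrite big_ord0.
Qed.

Lemma bar_coord_span k (w : bar_sum k) :
  w = \sum_t bar_coord t w *: gen k t.
Proof.
apply/dsumvP => s.
have pD : {morph (fun w : bar_sum k => dproj s w) : u v / u + v}.
  by move=> u v; rewrite dsumv_addE.
have p0 : dproj s (0 : bar_sum k) = 0.
  by apply: (addrI (dproj s (0 : bar_sum k))); rewrite -pD !addr0.
rewrite (big_morph _ pD p0) (bigD1 s) //= big1 => [|t ts]; last first.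
  by rewrite dsumv_scaleE dsumv_mkE eq_sym (negbTE ts) scaler0.
rewrite addr0 dsumv_scaleE dsumv_mkE eqxx /bar_coord.
move: (dproj s w); rewrite /= ; case: (_ <= _ <= _)%N => v.
  by apply/matrixP => i j; rewrite !mxE big_ord1 mulr1 !ord1.
by apply/matrixP => -[].
Qed.

(** A bar born at the target has zero generator at the source, whence the scalar; for a bar that
    dies after the source, the generator at the target is already 0. *)
Lemma parrow_gen i t : parrow bar_sum i (gen (src i) t)
  = (covers (tag t) (src i))%:R *: gen (tgt i) t.
Proof.
apply/dsumvP => s; rewrite lfunE /= dsumv_scaleE !dsumv_mkE.
case: eqP => [->|_]; last by rewrite linear0 scaler0.
rewrite lfunE /= -/(covers (tag t) (src i)).
case: covers => /=; case: (_ <= _ <= _)%N => /=;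
  apply/matrixP => a b; rewrite !mxE ?big_ord1 ?big_ord0 ?mxE ?mulr1 ?mul0r //.
all: try by case: a.
by rewrite !ord1.
Qed.

(** * Transport to the chosen bases of the module *)

Section Bases.
Variables (V : persmod F l) (e : forall k : 'I_l.+1, (\dim {: V k}).-tuple (V k)).
Hypothesis e_basis : forall k, basis_of {: V k}%VS (e k).
Variable phi : forall k, 'Hom(V k, bar_sum k).
Hypothesis phi_arrow : forall i : 'I_l,
  (phi (tgt i) \o parrow V i = parrow bar_sum i \o phi (src i))%VF.
Hypothesis phi_bij : forall k, bijective (phi k).

Let phiK k : cancel (phi k) (phi k)^-1%VF.
Proof. by apply: lker0_lfunK; apply/lker0P; exact: bij_inj. Qed.

Let phiVK k : cancel (phi k)^-1%VF (phi k).
Proof.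
move=> w; apply: limg_lfunVK; have [psi _ psiK] := phi_bij k.
by rewrite -[w]psiK memv_img ?memvf.
Qed.

(** This and [coord_mx] instantiate [U] and [C]; the next three lemmas are the hypotheses [UC], [CU]
    and [AU]. *)
Definition gen_mx k : 'M[F]_(\dim {: V k}, nbars d) :=
  \matrix_(j, t) coord (e k) j ((phi k)^-1%VF (gen k (enum_val t))).

Definition coord_mx k : 'M[F]_(nbars d, \dim {: V k}) :=
  \matrix_(t, j) bar_coord (enum_val t) (phi k (e k)`_j).

Lemma gen_coord_mx k : gen_mx k *m coord_mx k = 1%:M.
Proof.
apply/matrixP=> i j; rewrite !mxE.
transitivity (coord (e k) i (e k)`_j); last first.
  by rewrite coord_free 1?eq_sym ?(basis_free (e_basis k)).
(* Expand the image of the basis vector under [phi k] in the generators, then pull back. *)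
rewrite -[(e k)`_j in RHS]phiK.
rewrite [phi k _ in RHS]bar_coord_span !linear_sum.
rewrite (reindex (@enum_val (bar d) predT)) /=; last first.
  by exists enum_rank => u _; [rewrite enum_valK|rewrite enum_rankK].
by apply: eq_bigr => t _; rewrite !linearZ !mxE mulrC.
Qed.

Lemma coord_gen_mx k : coord_mx k *m gen_mx k = alive F d k.
Proof.
apply/matrixP=> s t; rewrite !mxE.
transitivity (bar_coord (enum_val s) (gen k (enum_val t))).
  rewrite -[in RHS](phiVK (gen k _)).
  rewrite [(phi k)^-1%VF _ in RHS](coord_basis (e_basis k)) ?memvf //.
  rewrite linear_sum (eq_bigr _ (fun j _ => linearZ _ _)) bar_coord_sum.
  by apply: eq_bigr => j _; rewrite !mxE mulrC.
rewrite bar_coord_gen (inj_eq enum_val_inj) /btype.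
by case: eqP => [->|_]; rewrite ?mulr1n ?mulr0n.
Qed.

Lemma repr_gen_mx i :
  repr_mx e i *m gen_mx (src i) = gen_mx (tgt i) *m alive F d (src i).
Proof.
apply/matrixP=> j t; rewrite mul_mx_diag !mxE.
set v := (phi (src i))^-1%VF (gen (src i) (enum_val t)).
(* Column [t] of the product holds the coordinates of the image of [v]; naturality of [phi] then
   reduces to [parrow_gen]. *)
transitivity (passmx.rVof (e (tgt i)) (parrow V i v) 0 j).
  rewrite (passmx.rVof_app _ (e_basis (src i))) mxE.
  by apply: eq_bigr => m _; rewrite !mxE mulrC.
rewrite mxE -[parrow V i v]phiK.
have := congr1 (fun h : 'Hom(_, _) => h v) (phi_arrow i).
rewrite !comp_lfunE => ->; rewrite phiVK parrow_gen !linearZ.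
by rewrite mulrC.
Qed.

Lemma stab_blocks_bij :
  exists f : @Stab F l (fun k => \dim {: V k}) (repr_mx e) ->
             GL_prod F d * Mat_prod F d,
    bijective f.
Proof.
by eexists; exact: (to_blocks_bij gen_coord_mx coord_gen_mx repr_gen_mx).
Qed.

End Bases.
End Coordinates.

Theorem theorem3p4 (F : fieldType) (l : nat) (V : persmod F l)
    (e : forall k : 'I_l.+1, (\dim {: V k}).-tuple (V k))
    (he : forall k : 'I_l.+1, basis_of {: V k}%VS (e k))
    (d : pinterval l -> nat) (hd : has_multiplicities V d) :
  exists phi : @Stab F l (fun k => \dim {: V k}) (repr_mx e) ->
               GL_prod F d * Mat_prod F d,
    bijective phi.
Proof. by case: hd => phi [phiA phi_bij]; exact: stab_blocks_bij phiA phi_bij. Qed.
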